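(* Let $\beta\ge 2$ and $t\ge 0$ be integers, and let $G$ be a cactus with $2\beta$ vertices, exactly $t$ cycles, and a perfect matching. Then $$SO(G)\le \Phi(\beta,t)=(\beta+t-1)\sqrt{(\beta+t)^{2}+4}+\sqrt{(\beta+t)^{2}+1}+\sqrt{5}\,(\beta-t-1)+2\sqrt{2}\,t,$$ with equality if and only if $G\cong H^{*}(2\beta,t)$.
   Context: All graphs are finite, simple and connected. For a graph $G$, $d_u$ denotes the degree of vertex $u$, and the Sombor index is $SO(G)=\sum_{uv\in E(G)}\sqrt{d_u^2+d_v^2}$. A cactus is a connected graph in which any two cycles have at most one common vertex. (A cactus with $2\beta$ vertices has at most $\beta-1$ cycles.) For integers $\beta\ge 1$ and $0\le t\le \beta-1$, $H^{*}(2\beta,t)$ denotes the graph with a center vertex $c$, consisting of $t$ triangles that pairwise share only the vertex $c$, one pendant vertex adjacent to $c$, and $\beta-t-1$ paths $c\,u_i\,v_i$ of length 2 attached at $c$ (with $d_{u_i}=2$, $d_{v_i}=1$), all these pieces otherwise disjoint; it has $2\beta$ vertices, $t$ cycles, $d_c=\beta+t$, and a perfect matching, and $SO(H^{*}(2\beta,t))=\Phi(\beta,t)$. *)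

(* Defs.v *)
From mathcomp Require Import all_boot all_order all_algebra.
Set Implicit Arguments. Unset Strict Implicit. Unset Printing Implicit Defensive.
Import Order.TTheory GRing.Theory Num.Theory.

Section Graphs.
Variable T : finType.
Variable e : rel T.

Definition simple_graph : Prop := symmetric e /\ irreflexive e.

Definition connected_graph : Prop := forall x y : T, connect e x y.

Definition deg (x : T) : nat := #|[pred y | e x y]|.

Definition edge_set : {set {set T}} :=
  [set A : {set T} | [exists x, exists y, e x y && (A == [set x; y])]].

Definition vset (F : {set {set T}}) : {set T} := \bigcup_(A in F) A.

(* a cycle of G = a nonempty connected 2-regular subgraph, given by its edge set *)
Definition is_cycle (F : {set {set T}}) : bool :=
  [&& F != set0, F \subset edge_set,
      [forall x, (#|[set A in F | x \in A]| == 0) || (#|[set A in F | x \in A]| == 2)]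
    & [forall x in vset F, forall y in vset F,
         connect (fun u v => [set u; v] \in F) x y]].

Definition cycles : {set {set {set T}}} := [set F | is_cycle F].

Definition num_cycles : nat := #|cycles|.

Definition cactus : Prop :=
  forall F1 F2, F1 \in cycles -> F2 \in cycles -> F1 != F2 ->
    #|vset F1 :&: vset F2| <= 1.

Definition has_perfect_matching : Prop :=
  exists M : {set {set T}}, M \subset edge_set /\
    forall x : T, #|[set A in M | x \in A]| = 1.

Local Open Scope ring_scope.

(* Sombor index: each edge uv is counted twice in the ordered double sum *)
Definition sombor (R : rcfType) : R :=
  2^-1 * \sum_(x : T) \sum_(y : T | e x y)
           Num.sqrt (((deg x) ^ 2 + (deg y) ^ 2)%N%:R).

End Graphs.

Local Open Scope ring_scope.

Definition Phi (R : rcfType) (beta t : nat) : R :=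
  (beta%:R + t%:R - 1) * Num.sqrt (((beta + t) ^ 2 + 4)%N%:R)
  + Num.sqrt (((beta + t) ^ 2 + 1)%N%:R)
  + Num.sqrt 5 * (beta%:R - t%:R - 1)
  + 2 * Num.sqrt 2 * t%:R.

(* The graph H*(2 beta, t) on vertex set {0, ..., 2 beta - 1}:
   0 = center c; triangles {c, 2i-1, 2i} for i = 1..t; pendant 2t+1;
   paths c - (2t+2+2j) - (2t+3+2j) for j = 0 .. beta-t-2. *)
Definition Hstar_edge (t a b : nat) : bool :=
  [|| (a == 0%N) && (1 <= b <= 2 * t + 1)%N,
      (a == 0%N) && (2 * t + 2 <= b)%N && ~~ odd (b - (2 * t + 2)),
      odd a && (a <= 2 * t)%N && (b == a.+1)
    | (2 * t + 2 <= a)%N && ~~ odd (a - (2 * t + 2)) && (b == a.+1)].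

Definition Hstar (beta t : nat) : rel 'I_(2 * beta) :=
  fun x y => Hstar_edge t x y || Hstar_edge t y x.

Arguments Hstar : clear implicits.

Definition isomorphic (T1 T2 : finType) (e1 : rel T1) (e2 : rel T2) : Prop :=
  exists f : T1 -> T2, bijective f /\ forall x y, e2 (f x) (f y) = e1 x y.

(* Main.v *)
(* Write D = beta + t and call an edge outside the perfect matching free.  Every
   graph has at least |E| - |V| + (number of components) cycles, so there are at
   most D - 1 free edges; hence a vertex has degree at most D, and the end
   degrees of a free edge sum to at most D + 2.

   If a vertex c has degree D then all free edges meet c, which forces G to be
   H* and gives SO(G) = Phi.  Otherwise all degrees are at most D - 1, so a free
   edge weighs at most sqrt((D-1)^2 + 9) (sqrt 8 when D = 3) instead of the
   sqrt(D^2 + 4) of H*.  A matching edge uv weighs at most d_u + d_v - 3 + sqrt 5.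
   Since edge-disjointness of the cycles gives 2t <= D - 1, the loss on the free
   edges outweighs what the matching edges can gain, and SO(G) < Phi. *)
Require Import Defs.
From mathcomp Require Import all_boot all_order all_algebra zify ring lra.
Import Order.TTheory GRing.Theory Num.Theory.

Set Implicit Arguments.
Unset Strict Implicit.
Unset Printing Implicit Defensive.

(** * Cycles as edge sets, obtained from cyclic vertex sequences *)

Lemma set2_inj (T : finType) (x y z : T) : [set x; y] = [set x; z] -> y = z.
Proof.
move=> /setP E; have := E y; have := E z.
rewrite !inE !eqxx !orbT => /orP[/eqP zx|/eqP->//] /esym/orP[/eqP yx|/eqP//].
by rewrite zx yx.
Qed.

Section CycleFromSequence.
Variables (T : finType) (e : rel T) (q : seq T).
Hypotheses (cq : cycle e q) (uq : uniq q) (q3 : 2 < size q).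

Definition cycle_edges : {set {set T}} := [set [set x; next q x] | x in q].

(** This is where length at least 3 enters: it keeps the edges from [x] to its successor and to its
    predecessor distinct, so every vertex of the cycle has degree exactly 2. *)
Lemma next_next_neq x : x \in q -> next q (next q x) != x.
Proof.
move=> xq; have [i q' E] := rot_to xq.
have := q3; have := uq; rewrite -(rot_uniq i) -(size_rot i) -!(next_rot i uq) E.
case: q' {E} => [|y [|z q']] //= /and3P[]; rewrite !inE !negb_or eqxx.
move=> /and3P[xy xz _] _ _ _.
by rewrite (eq_sym y) (negPf xy) eqxx eq_sym.
Qed.

Lemma cycle_edges_at x : x \in q ->
  [set A in cycle_edges | x \in A] = [set [set x; next q x]; [set prev q x; x]].
Proof.
move=> xq; apply/setP=> A; rewrite !inE; apply/andP/orP.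
  case=> /imsetP[y yq ->]; rewrite !inE => /orP[/eqP->|/eqP E]; first by left.
  by right; rewrite E prev_next.
case=> /eqP->; rewrite !inE eqxx ?orbT; split=> //; apply/imsetP.
  by exists x.
by exists (prev q x); rewrite ?mem_prev ?next_prev.
Qed.

Lemma cycle_edges_is_cycle : is_cycle e cycle_edges.
Proof.
have vq x : x \in vset cycle_edges -> x \in q.
  case/bigcupP=> A /imsetP[y yq ->]; rewrite !inE => /orP[]/eqP->//.
  by rewrite mem_next.
apply/and4P; split.
- have: 0 < size q by apply: leq_trans q3.
  rewrite -has_predT => /hasP[x xq _].
  by apply/set0Pn; exists [set x; next q x]; apply/imsetP; exists x.
- apply/subsetP=> A /imsetP[x xq ->]; rewrite inE.
  apply/existsP; exists x; apply/existsP; exists (next q x).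
  by rewrite eqxx andbT next_cycle.
- apply/forallP=> x; case xq: (x \in q); last first.
    rewrite cards_eq0; apply/orP; left; apply/eqP/setP=> A; rewrite !inE.
    apply/negP=> /andP[FA xA]; suff: x \in q by rewrite xq.
    by apply: vq; apply/bigcupP; exists A.
  rewrite cycle_edges_at // cards2; apply/orP; right.
  case: ([set x; next q x] =P _) => //; rewrite (setUC [set prev q x]) => /set2_inj E.
  by have := next_next_neq xq; rewrite E next_prev // eqxx.
- apply/forallP=> x; apply/implyP=> /vq xq.
  apply/forallP=> y; apply/implyP=> /vq yq.
  have: fconnect (next q) x y by rewrite (fconnect_cycle (cycle_next uq)).
  case/connectP=> p.
  elim: p x xq {yq} => [|z p IH] x xq /= => [_ ->|/andP[/eqP<- pp] E].
    exact: connect0.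
  apply: (@connect_trans _ _ (next q x)); last by apply: IH=> //; rewrite mem_next.
  by apply: connect1; apply/imsetP; exists x.
Qed.
End CycleFromSequence.

(** * A lower bound on the number of cycles, by deleting edges *)

Section CyclomaticBound.
Variable T : finType.
Implicit Types e : rel T.

Definition del_edge e (u v : T) : rel T :=
  fun x y => e x y && ([set x; y] != [set u; v]).

Lemma del_edge_sub e u v : subrel (del_edge e u v) e.
Proof. by move=> x y /andP[]. Qed.

Lemma del_edge_sym e u v : symmetric e -> symmetric (del_edge e u v).
Proof. by move=> es x y; rewrite /del_edge es setUC. Qed.

Lemma edge_set_del e u v : [set u; v] \notin edge_set (del_edge e u v).
Proof.
rewrite inE; apply/existsP=> [[x /existsP[y]]]; rewrite /del_edge -andbA.
by case/and3P=> _ /eqP xy /eqP uv; apply: xy.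
Qed.

Lemma cycles_del_sub e u v : cycles (del_edge e u v) \subset cycles e.
Proof.
apply/subsetP=> F; rewrite !inE => /and4P[F0 Fe F2 Fc]; apply/and4P; split=> //.
apply: subset_trans Fe _; apply/subsetP=> A; rewrite !inE.
case/existsP=> x /existsP[y /andP[/del_edge_sub exy A_]].
by apply/existsP; exists x; apply/existsP; exists y; rewrite exy.
Qed.

(** A simple path from [u] to [v] avoiding the edge [uv] closes up with [uv] to a cycle. That cycle
    is lost on deletion, while deletion creates no new cycle. *)
Lemma connect_del_cycle e u v : symmetric e -> irreflexive e -> e u v ->
  connect (del_edge e u v) u v -> num_cycles (del_edge e u v) < num_cycles e.
Proof.
move=> es ei euv /connectP[p0 pp0 v0].
have [p [pp up vp]] : exists p, [/\ path (del_edge e u v) u p, uniq (u :: p)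
    & v = last u p].
  by move: v0; case/shortenP: pp0 => p pp up _ E; exists p.
have cp : cycle e (u :: p).
  rewrite /= rcons_path -vp es euv andbT.
  by apply: sub_path pp; apply: del_edge_sub.
(* An empty path would make [uv] a loop, and a path of one step would be the deleted edge itself. *)
have p3 : 2 < size (u :: p).
  case: p pp {up cp} vp => [|y [|z p]] //=.
    by move=> _ vu; rewrite vu ei in euv.
  by move=> /[swap] ->; rewrite /del_edge eqxx andbF.
apply: proper_card; apply/properP; split; first exact: cycles_del_sub.
exists (cycle_edges (u :: p)); first by rewrite inE cycle_edges_is_cycle.
rewrite inE; apply/negP=> /and4P[_ /subsetP Fe _ _].
have := edge_set_del e u v; rewrite Fe //.
apply/imsetP; exists v; first by rewrite vp mem_last.
have vq: v \in u :: p by rewrite vp mem_last.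
have iv : index v (u :: p) = size p by rewrite vp index_last.
(* Since [v] is last, the lookup of its successor runs off the end of [p] and returns the default,
   the head [u]; the closing edge is thus [uv]. *)
by rewrite next_nth vq iv nth_default // setUC.
Qed.

Definition components e := [set [set y | connect e x y] | x in T].

(** The product is 1 exactly when [uv] is a bridge. The map [g] sends each component left after
    deletion to the component of [e] containing it; it is onto, and for a bridge it merges the
    components of [u] and [v], so it is not injective. *)
Lemma card_components_del e u v : symmetric e ->
  #|components e| + ~~ connect (del_edge e u v) u v * e u v
  <= #|components (del_edge e u v)|.
Proof.
move=> es; set e' := del_edge e u v.
pose g (C : {set T}) := [set y | [exists x in C, connect e x y]].
have gE x : g [set y | connect e' x y] = [set y | connect e x y].
  apply/setP=> y; rewrite !inE; apply/existsP/idP.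
    case=> z; rewrite inE => /andP[xz]; apply: connect_trans.
    apply: connect_sub xz => a b /del_edge_sub; exact: connect1.
  by exists x; rewrite inE connect0.
have E : components e = g @: components e'.
  rewrite -imset_comp; apply: eq_imset => x /=; by rewrite gE.
case: (boolP (connect e' u v)) => uv; first by rewrite E addn0 leq_imset_card.
case: (boolP (e u v)) => euv; last by rewrite E addn0 leq_imset_card.
rewrite addn1 ltn_neqAle E leq_imset_card andbT; apply/negP=> /imset_injP inj.
have: [set y | connect e' u y] = [set y | connect e' v y].
  apply: inj; try exact: imset_f; rewrite !gE.
  by apply/setP=> y; rewrite !inE (same_connect1 (sym_connect_sym es) euv).
by move/setP/(_ v); rewrite !inE connect0 (negPf uv).
Qed.

Lemma sum_deg_del e u v : symmetric e -> irreflexive e -> e u v ->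
  \sum_x deg e x = (\sum_x deg (del_edge e u v) x) + 2.
Proof.
move=> es ei euv.
have uv : u != v by apply/eqP=> uv; rewrite uv ei in euv.
have del a b : e a b -> [set a; b] = [set u; v] -> 
   deg e a = (deg (del_edge e u v) a).+1.
  move=> eab ab; rewrite /deg (cardD1 b) inE eab add1n; congr _.+1.
  apply: eq_card => y; rewrite !inE /del_edge andbC -ab; congr andb.
  by congr negb; apply/eqP/eqP=> [->|/set2_inj].
have deln x : x != u -> x != v -> deg e x = deg (del_edge e u v) x.
  move=> xu xv; apply: eq_card => y; rewrite !inE /del_edge.
  case: eqP => [E|]; last by rewrite andbT.
  by have := set21 x y; rewrite E !inE (negPf xu) (negPf xv).
have split2 (F : T -> nat) :
    \sum_x F x = F u + (F v + \sum_(x | (x != u) && (x != v)) F x).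
  by rewrite (bigD1 u) //= (bigD1 v) // eq_sym.
rewrite !split2 (del u v) // (del v u) 1?es 1?setUC //.
rewrite (eq_bigr (deg (del_edge e u v))); first lia.
by move=> x /andP[xu xv]; apply: deln.
Qed.

(** Twice the inequality |E| - |V| + (number of components) <= (number of cycles), with the degree
    sum in place of 2|E|. In the induction, removing an edge lowers the degree sum by 2 and either
    destroys a cycle or, for a bridge, adds a component. *)
Lemma cyclomatic_bound e : symmetric e -> irreflexive e ->
  (\sum_x deg e x) + 2 * #|components e| <= 2 * #|T| + 2 * num_cycles e.
Proof.
move: {2}(\sum_x _) (leqnn (\sum_x deg e x)) => k.
have base e0 : \sum_x deg e0 x = 0 ->
    (\sum_x deg e0 x) + 2 * #|components e0| <= 2 * #|T| + 2 * num_cycles e0.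
  have: #|components e0| <= #|T| by exact: leq_imset_card.
  lia.
elim: k e => [|k IH] e ek es ei; first by apply: base; lia.
case: (pickP (fun p : T * T => e p.1 p.2)) => [[u v] /= euv|e0]; last first.
  by apply: base; apply: big1 => x _; apply: eq_card0 => y; apply: (e0 (x, y)).
have s := sum_deg_del es ei euv.
have di : irreflexive (del_edge e u v) by move=> x; rewrite /del_edge ei.
have {IH} := IH (del_edge e u v) _ (del_edge_sym u v es) di.
have := card_components_del u v es; rewrite euv muln1.
have := connect_del_cycle es ei euv.
have : num_cycles (del_edge e u v) <= num_cycles e.
  exact/subset_leq_card/cycles_del_sub.
case: connect => /= c1 c2 c3 H.
  by have := H ltac:(lia); have := c2 isT; lia.
by have := H ltac:(lia); lia.
Qed.
End CyclomaticBound.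

(** * Counting edges and cycles in a cactus *)

Section CactusBound.
Variables (T : finType) (e : rel T).
Hypotheses (es : symmetric e) (ei : irreflexive e).

Lemma edge_setP (A : {set T}) :
  reflect (exists x y, e x y /\ A = [set x; y]) (A \in edge_set e).
Proof.
rewrite inE; apply: (iffP existsP) => [[x /existsP[y /andP[exy /eqP->]]]|].
  by exists x, y.
by case=> x [y [exy ->]]; exists x; apply/existsP; exists y; rewrite exy eqxx.
Qed.

Lemma edge_neq x y : e x y -> x != y.
Proof. by move=> exy; apply/eqP=> E; rewrite E ei in exy. Qed.

(** Incident pairs of a vertex and an edge are counted in two ways; the edges at [x] lie in the
    image of its neighbours [y] under the map to [[set x; y]]. *)
Lemma handshake : 2 * #|edge_set e| <= \sum_x deg e x.
Proof.
have E : \sum_(A in edge_set e) #|A| = 2 * #|edge_set e|.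
  rewrite mulnC -sum_nat_const; apply: eq_bigr => A /edge_setP[x [y [exy ->]]].
  by rewrite cards2 edge_neq.
rewrite -E; under eq_bigr => A _ do rewrite -sum1_card big_mkcond /=.
rewrite exchange_big; apply: leq_sum => x _.
rewrite -big_mkcondr /= sum1_card /deg.
apply: leq_trans (leq_imset_card (fun y => [set x; y]) _).
apply: subset_leq_card; apply/subsetP=> A.
rewrite unfold_in => /andP[/edge_setP[a [b [eab ->]]]].
rewrite !inE => /orP[]/eqP->; apply/imsetP; first by exists b.
by exists a; rewrite ?inE 1?es // setUC.
Qed.

Lemma cycle_other F A x : is_cycle e F -> A \in F -> x \in A ->
  exists2 B, B \in F & (x \in B) && (B != A).
Proof.
case/and4P=> _ _ /forallP/(_ x) F2 _ FA xA.
have: A \in [set A in F | x \in A] by rewrite !inE FA.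
case/orP: F2 => [|/eqP F2 Ax]; first by rewrite cards_eq0 => /eqP->; rewrite inE.
have : 0 < #|[set A in F | x \in A] :\ A|.
  by move: F2; rewrite (cardsD1 A) Ax; lia.
case/card_gt0P=> B; rewrite !inE => /and3P[BA FB xB].
by exists B; rewrite // xB.
Qed.

(** From an edge [A] with ends [a] and [b], take the other cycle edges [B] at [a] and [C] at [b].
    They differ, since an edge through both [a] and [b] would be [A]. *)
Lemma cycle_card F : is_cycle e F -> 3 <= #|F|.
Proof.
move=> cF; have /and4P[/set0Pn[A FA] /subsetP Fe _ _] := cF.
have /edge_setP[a [b [eab Aab]]] := Fe _ FA.
have aA : a \in A by rewrite Aab set21.
have bA : b \in A by rewrite Aab set22.
have [B FB /andP[aB BA]] := cycle_other cF FA aA.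
have [C FC /andP[bC CA]] := cycle_other cF FA bA.
have bB : b \notin B.
  apply: contra BA => bB; rewrite Aab; have /edge_setP[c [d [ecd Bcd]]] := Fe _ FB.
  move: aB bB (edge_neq eab); rewrite Bcd !inE.
  by case/orP=> /eqP-> /orP[]/eqP->; rewrite ?eqxx // setUC.
have CB : C != B by apply: contraNneq bB => <-.
have <- : #|[set A; B; C]| = 3.
  by rewrite setUC cardsU1 cards2 !inE negb_or CA CB eq_sym BA.
apply: subset_leq_card; apply/subsetP=> D; rewrite !inE.
by case/orP=> [/orP[]|] /eqP->.
Qed.

(** Two cycles with a common edge would share its two ends, so distinct cycles are edge-disjoint,
    and each uses at least three edges. *)
Lemma cactus_num_cycles : cactus e -> 3 * num_cycles e <= #|edge_set e|.
Proof.
move=> ce; have triv : trivIset (cycles e).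
  apply/trivIsetP=> F1 F2 c1 c2 F12; apply/pred0P=> A /=; apply/negbTE/negP.
  case/andP=> A1 A2; have := ce _ _ c1 c2 F12; apply/negP; rewrite -ltnNge.
  have : A \in edge_set e.
    by move: c1; rewrite inE => /and4P[_ /subsetP/(_ A A1)].
  case/edge_setP=> x [y [exy Axy]].
  have <- : #|A| = 2 by rewrite Axy cards2 edge_neq.
  by apply: subset_leq_card; rewrite subsetI; apply/andP; split;
    apply: bigcup_sup.
have : cover (cycles e) \subset edge_set e.
  by apply/bigcupsP=> F; rewrite inE => /and4P[].
move/subset_leq_card; apply: leq_trans.
rewrite -(eqP triv) mulnC -sum_nat_const; apply: leq_sum => F.
by rewrite inE => /cycle_card.
Qed.

Lemma sum_deg_le : #|T| != 0 -> \sum_x deg e x + 2 <= 2 * #|T| + 2 * num_cycles e.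
Proof.
rewrite -lt0n => /card_gt0P[x _].
have := cyclomatic_bound es ei.
suff: 0 < #|components e| by lia.
apply/card_gt0P; exists [set y | connect e x y]; exact: imset_f.
Qed.

(** With t cycles, 3t <= |E| <= |V| + t - 1. *)
Lemma cactus_num_cycles_lt : cactus e -> #|T| != 0 -> 2 * num_cycles e < #|T|.
Proof.
move=> ce T0; have := sum_deg_le T0; have := handshake.
have := cactus_num_cycles ce; lia.
Qed.
End CactusBound.

(** By convexity the extreme pair is (m, 3): for a = x + 3 and b = y + 3 the slack at total x + y +
    6 is 2xy. If one of the numbers is 2, the bound m^2 + 4 is enough. *)
Lemma sum_squares_le (a b m : nat) : 1 < a <= m -> 1 < b <= m ->
  a + b <= m + 3 -> a ^ 2 + b ^ 2 <= m ^ 2 + 9.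
Proof.
move=> /andP[a2 am] /andP[b2 bm] ab.
have sq (x : nat) : x <= m -> x ^ 2 + 4 <= m ^ 2 + 9.
  by move=> xm; have := leq_sqr x m; rewrite xm; lia.
have [a3|a3] := leqP 3 a; last by rewrite (_ : a = 2) 1?addnC ?sq //; lia.
have [b3|b3] := leqP 3 b; last by rewrite (_ : b = 2) ?sq //; lia.
have : (a + b - 3) ^ 2 <= m ^ 2 by rewrite leq_sqr; lia.
have [x ->] : exists x, a = x + 3 by exists (a - 3); lia.
have [y ->] : exists y, b = y + 3 by exists (b - 3); lia.
rewrite (_ : x + 3 + (y + 3) - 3 = x + y + 3); last lia.
nia.
Qed.

(** * Perfect matchings and the free edges they leave *)

(** A perfect matching as the involution exchanging the ends of its edges; it has no fixed point
    when [e] is irreflexive. *)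
Definition mate_of (T : finType) (e : rel T) (mu : T -> T) : Prop :=
  involutive mu /\ forall x, e x (mu x).

Lemma perfect_matching_mate (T : finType) (e : rel T) :
  symmetric e -> irreflexive e -> has_perfect_matching e ->
  exists mu, mate_of e mu.
Proof.
move=> es ei [M [/subsetP ME M1]].
have ex x : exists y, [set x; y] \in M.
  have /eqP/cards1P[A EA] := M1 x; have: A \in [set A in M | x \in A].
    by rewrite EA set11.
  rewrite inE => /andP[MA xA]; have /edge_setP[a [b [_ Aab]]] := ME _ MA.
  move: MA xA; rewrite Aab !inE => MA /orP[]/eqP->; first by exists b.
  by exists a; rewrite setUC.
have uq x y z : [set x; y] \in M -> [set x; z] \in M -> y = z.
  move=> xy xz; have /eqP/cards1P[A EA] := M1 x.
  have: [set x; y] \in [set A in M | x \in A] by rewrite inE xy set21.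
  have: [set x; z] \in [set A in M | x \in A] by rewrite inE xz set21.
  by rewrite EA !inE => /eqP<- /eqP /set2_inj.
pose mu x := xchoose (ex x); have muM x : [set x; mu x] \in M by exact: (xchooseP (ex x)).
exists mu; split=> x.
  by apply: (uq (mu x)); rewrite // setUC.
have /edge_setP[a [b [eab]]] := ME _ (muM x).
have [-> /set2_inj->//|xa E] := eqVneq x a.
have: x \in [set a; b] by rewrite -E set21.
rewrite !inE (negPf xa) => /= /eqP xb.
by move: E; rewrite -xb (setUC [set a]) => /set2_inj->; rewrite es xb.
Qed.

Section NonMatching.
Variables (T : finType) (e : rel T) (mu : T -> T).
Hypotheses (es : symmetric e) (ei : irreflexive e) (mateE : mate_of e mu).

Definition nm : rel T := fun x y => e x y && (y != mu x).
Definition nmdeg x : nat := \sum_y nm x y.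

Lemma muK : involutive mu. Proof. by case: mateE. Qed.
Lemma e_mu x : e x (mu x). Proof. by case: mateE. Qed.
Lemma mu_neq x : mu x != x.
Proof. by rewrite eq_sym; exact: (edge_neq ei (e_mu x)). Qed.

Lemma nm_sym : symmetric nm.
Proof. by move=> x y; rewrite /nm es -(inj_eq (inv_inj muK)) muK eq_sym. Qed.

Lemma nm_mu x : nm x (mu x) = false.
Proof. by rewrite /nm eqxx andbF. Qed.

Lemma nm_irr : irreflexive nm.
Proof. by move=> x; rewrite /nm ei. Qed.

Lemma edgeE x y : e x y = (y == mu x) || nm x y.
Proof. by rewrite /nm; case: eqP => [->|] /=; rewrite ?e_mu ?andbT. Qed.

Lemma degE x : deg e x = (nmdeg x).+1.
Proof.
rewrite /deg (cardD1 (mu x)) inE e_mu add1n /nmdeg -sum1_card big_mkcond /=.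
congr _.+1; apply: eq_bigr => y _; rewrite inE /= /nm inE andbC.
by case: andP.
Qed.

Lemma nmdeg_rec c : \sum_(x | x != c) nm x c = nmdeg c.
Proof.
rewrite /nmdeg [RHS](bigD1 c) //= nm_irr add0n.
by apply: eq_bigr => x _; rewrite nm_sym.
Qed.

Lemma nm_le_nmdeg x y : nm x y <= nmdeg x.
Proof. by rewrite /nmdeg (bigD1 y) //= leq_addr. Qed.

Lemma nmdeg_gt0 x y : nm x y -> 0 < nmdeg x.
Proof. by move=> nxy; have := nm_le_nmdeg x y; rewrite nxy. Qed.

(** Each free edge at [c] is counted once at [c] and once more at its other end. *)
Lemma nmdeg2_le c : 2 * nmdeg c <= \sum_x nmdeg x.
Proof.
rewrite (bigD1 c) //= mulSn mul1n leq_add2l -[leqLHS]nmdeg_rec.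
by apply: leq_sum => x _; apply: nm_le_nmdeg.
Qed.

(** The equality case of [nmdeg2_le]: every free edge meets [c]. *)
Lemma nmdeg_center c x : \sum_x nmdeg x <= 2 * nmdeg c -> x != c ->
  nmdeg x = nm x c.
Proof.
move=> le xc.
have rec := nmdeg_rec c; rewrite (bigD1 x) //= in rec.
rewrite (bigD1 c) //= (bigD1 x) //= in le.
have: \sum_(i | (i != c) && (i != x)) nm i c <=
    \sum_(i | (i != c) && (i != x)) nmdeg i.
  by apply: leq_sum => i _; apply: nm_le_nmdeg.
have := nm_le_nmdeg x c; move: le rec => /=; lia.
Qed.

(** The free edges at [u] and those at [v] have only [uv] in common, so together they are
    [nmdeg u + nmdeg v - 1] edges, each counted twice in the sum. *)
Lemma nm_edge_le u v : nm u v -> 2 * (nmdeg u + nmdeg v) <= \sum_x nmdeg x + 2.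
Proof.
move=> nuv; have uv : u != v by apply/eqP=> E; rewrite E nm_irr in nuv.
have vu : v != u by rewrite eq_sym.
have := nmdeg_rec u; rewrite (bigD1 v) //= nm_sym nuv => Eu.
have := nmdeg_rec v; rewrite (bigD1 u) //= nuv => Ev.
rewrite (bigD1 u) //= (bigD1 v) //=.
rewrite (eq_bigl (fun i => (i != u) && (i != v))) in Ev; last first.
  by move=> i; rewrite andbC.
have : \sum_(i | (i != u) && (i != v)) nm i u +
   \sum_(i | (i != u) && (i != v)) nm i v <=
   \sum_(i | (i != u) && (i != v)) nmdeg i.
  rewrite -big_split /=; apply: leq_sum => i /andP[iu iv].
  by rewrite /nmdeg (bigD1 u) //= (bigD1 v) //= addnA leq_addr.
by move: Eu Ev => /=; lia.
Qed.

(** Otherwise [x] and its mate would form a whole connected component with only two vertices. *)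
Lemma nmdeg_mate_gt0 x : connected_graph e -> 2 < #|T| ->
  0 < nmdeg x + nmdeg (mu x).
Proof.
move=> ec T2; rewrite lt0n; apply/negP; rewrite addn_eq0 => /andP[/eqP x0 /eqP m0].
have nm0 y z : nmdeg y = 0 -> nm y z = false.
  by move=> y0; have := nm_le_nmdeg y z; rewrite y0; case: nm.
have cl : closed e (pred2 x (mu x)).
  apply: intro_closed; first exact: sym_connect_sym.
  move=> a b; rewrite edgeE => eab /orP[]/eqP E; move: eab; rewrite E nm0 // orbF.
    by move=> /eqP->; rewrite inE eqxx orbT.
  by rewrite muK => /eqP->; rewrite inE eqxx.
have : #|T| <= #|pred2 x (mu x)|.
  apply: subset_leq_card; apply/subsetP=> y _.
  by rewrite -(closed_connect cl (ec x y)) inE eqxx.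
by rewrite card2; case: (_ != _); lia.
Qed.
End NonMatching.

(** * The labelled graph H*: its matching, its star and its central degree *)

Section HstarStructure.
Variable t : nat.

(* The neighbours of the center 0 of H*, without its matched pendant vertex. *)
Definition Hstar_star (i : nat) : bool :=
  (0 < i <= 2 * t) || (2 * t + 2 <= i) && ~~ odd i.

(** The perfect matching of H*. The smaller label of a non-central pair is odd in the triangles and
    even in the paths, which the parity test detects. *)
Definition Hstar_mate (i : nat) : nat :=
  if i == 0 then 2 * t + 1 else if i == 2 * t + 1 then 0
  else if odd i == (i <= 2 * t) then i.+1 else i.-1.

(** Splits H* into its matching and a star at 0, the shape that [edgeE] and [star_nm] give to an
    extremal graph. Writing [a] and [b] as twice their halves plus a parity leaves linear
    arithmetic. *)
Lemma Hstar_edgeE a b : Hstar_edge t a b || Hstar_edge t b a =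
  (b == Hstar_mate a) ||
    ((a == 0) && Hstar_star b || (b == 0) && Hstar_star a).
Proof.
rewrite /Hstar_edge /Hstar_mate /Hstar_star.
have o i : (2 * t + 2 <= i) && ~~ odd (i - (2 * t + 2)) =
    (2 * t + 2 <= i) && ~~ odd i.
  by case: leqP => //= ti; rewrite oddB // oddD oddM addbF.
rewrite -!andbA !(andbA (2 * t + 2 <= _)) !o.
have := odd_double_half a; have := odd_double_half b.
rewrite -!muln2; move: (a./2) (b./2) => a' b'.
case: (odd a); case: (odd b) => /= Eb Ea;
  case: (leqP (2 * t + 2) a) => ta; case: (leqP (2 * t + 2) b) => tb;
  case: (eqVneq a 0) => a0; case: (eqVneq a (2 * t + 1)) => a1;
  case: (leqP a (2 * t)) => a2 /=; lia.
Qed.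

(* The positions of the k-th non-central matching edge: the triangles come first,
   and the pendant vertex at 2t+1 shifts the paths by one. *)
Definition Hstar_pos (k : nat) (b : bool) : nat := 2 * k + (t <= k) + 1 + b.

Lemma Hstar_pos_inj k b l d : Hstar_pos k b = Hstar_pos l d -> k = l /\ b = d.
Proof.
rewrite /Hstar_pos => E.
have kl : k = l.
  by move: E; case: b; case: d; case: (leqP t k); case: (leqP t l) => /=; lia.
by split=> //; move: E; rewrite kl => /addnI; case: b; case: d.
Qed.

Lemma Hstar_pos_neq0 k b : Hstar_pos k b != 0.
Proof. by rewrite /Hstar_pos addnAC addn1. Qed.

Lemma Hstar_pos_neq k b : Hstar_pos k b != 2 * t + 1.
Proof. by rewrite /Hstar_pos; case: b; lia. Qed.

Lemma Hstar_mate_pos k b : Hstar_mate (Hstar_pos k b) = Hstar_pos k (~~ b).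
Proof.
rewrite /Hstar_mate (negPf (Hstar_pos_neq0 k b)) (negPf (Hstar_pos_neq k b)).
rewrite /Hstar_pos 3!oddD oddM; case: b; case: (leqP t k) => tk /=;
  case: leqP => tk' /=; lia.
Qed.

Lemma Hstar_star_pos k b : Hstar_star (Hstar_pos k b) = ~~ b || (k < t).
Proof.
rewrite /Hstar_star /Hstar_pos 3!oddD oddM; case: b; case: (leqP t k) => tk /=; lia.
Qed.

Lemma Hstar_center_deg beta (i : 'I_(2 * beta)) : t < beta -> i = 0 :> nat ->
  deg (Hstar beta t) i = beta + t.
Proof.
move=> tb i0; rewrite /deg -sum1_card.
pose P j := Hstar_edge t 0 j || Hstar_edge t j 0.
rewrite (eq_bigl (fun j : 'I_(2 * beta) => P j)); last first.
  by move=> j; rewrite inE /Hstar i0.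
rewrite big_mkcond -(big_mkord xpredT (fun j => (P j : nat))) /=.
have PE j : P j = (0 < j) && ((j <= 2 * t + 1) || ~~ odd j).
  rewrite /P Hstar_edgeE /Hstar_mate /Hstar_star /=; lia.
have count0 m : m <= 2 * t + 1 -> \sum_(0 <= j < m.+1) P j = m.
  elim: m => [_|m IH mt]; first by rewrite big_nat1 PE.
  rewrite big_nat_recr //= IH ?PE; lia.
have count k : \sum_(0 <= j < 2 * (t + 1 + k)) P j = 2 * t + 1 + k.
  elim: k => [|k IH].
    by rewrite (_ : 2 * (t + 1 + 0) = (2 * t + 1).+1) ?count0; lia.
  rewrite (_ : 2 * (t + 1 + k.+1) = (2 * (t + 1 + k)).+2); last lia.
  by rewrite 2?big_nat_recr //= IH !PE; lia.
(* The summand [beta - t - 1] is the number of paths; each contributes one neighbour of the center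
   beyond the first [2 * t + 1]. *)
by rewrite (_ : beta = t + 1 + (beta - t - 1)) ?count; lia.
Qed.
End HstarStructure.

Local Open Scope ring_scope.

(** * Edge weights and numerical estimates *)

Section Weights.
Variable R : rcfType.

Definition weight (a b : nat) : R := Num.sqrt ((a ^ 2 + b ^ 2)%N%:R).

Lemma weight_ge0 a b : 0 <= weight a b. Proof. exact: sqrtr_ge0. Qed.

Lemma weightC a b : weight a b = weight b a.
Proof. by rewrite /weight addnC. Qed.

Lemma sqrtr_natr_sqr n : Num.sqrt (n%:R : R) ^+ 2 = n%:R.
Proof. by rewrite sqr_sqrtr ?ler0n. Qed.

Lemma le_sqrt_nat (m n : nat) : (m <= n)%N ->
  Num.sqrt (m%:R : R) <= Num.sqrt n%:R.
Proof. by move=> mn; rewrite ler_wsqrtr // ler_nat. Qed.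

Lemma le_of_sqr (x y : R) : 0 <= y -> x ^+ 2 <= y ^+ 2 -> x <= y.
Proof.
move=> y0; have [x0|/ltW x0 _] := leP 0 x; last exact: le_trans x0 y0.
by rewrite ler_pXn2r ?nnegrE.
Qed.

(* As sqrt 5 >= 2, the squares differ by at least 2 (a - 1) (b - 1). *)
Lemma weight_le_linear (a b : nat) : (0 < a)%N -> (0 < b)%N -> (2 < a + b)%N ->
  weight a b <= a%:R + b%:R - 3 + Num.sqrt 5.
Proof.
move=> a0 b0 ab.
have q2 := sqrtr_natr_sqr 5; have q0 := sqrtr_ge0 (5%:R : R).
set q := Num.sqrt _ in q2 q0 *.
have w2 := sqrtr_natr_sqr (a ^ 2 + b ^ 2); have w0 := weight_ge0 a b.
rewrite -/(weight a b) natrD !natrX in w2.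
have {}a0 : 1 <= a%:R :> R by rewrite ler1n.
have {}b0 : 1 <= b%:R :> R by rewrite ler1n.
have {}ab : 3 <= a%:R + b%:R :> R by rewrite -natrD ler_nat.
have q_ge2 : 2 <= q by apply: le_of_sqr => //; rewrite q2; lra.
apply: le_of_sqr; rewrite ?w2; first lra.
set s : R := a%:R + b%:R - 3.
have sq : 0 <= s * (q - 2) by apply: mulr_ge0; rewrite /s; lra.
have ab1 : 0 <= (a%:R - 1) * (b%:R - 1) :> R by apply: mulr_ge0; lra.
have -> : (s + q) ^+ 2 = s ^+ 2 + 2 * (s * (q - 2)) + 4 * s + q ^+ 2 by ring.
rewrite q2 /s; nra.
Qed.

(** The left side bounds the Sombor index when no vertex has degree D: D - 1 free edges of weight at
    most sqrt k, and the linear bound of [weight_le_linear] summed over the [beta] matching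
    edges. *)
Lemma Phi_gap (beta t k : nat) : (2 < beta + t)%N -> (t < beta)%N ->
  (k <= if beta + t == 3 then 8 else (beta + t - 1) ^ 2 + 9)%N ->
  (beta + t - 1)%N%:R * Num.sqrt (k%:R : R) + beta%:R * (Num.sqrt 5 - 1)
    + (2 * (beta + t - 1))%N%:R < Phi R beta t.
Proof.
move=> D3 tb kle; rewrite /Phi.
have tN_nat : (2 * t <= beta + t - 1)%N by lia.
have D4_nat : (beta + t = 4 -> t <= 1)%N by lia.
have D5_nat : (beta + t != 3 -> beta + t != 4 -> 5 <= beta + t)%N by lia.
have sD : (beta + t)%:R = (beta%:R + t%:R : R) by rewrite natrD.
have sN : (beta + t - 1)%:R = (beta%:R + t%:R - 1 : R) by rewrite natrB ?natrD //; lia.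
rewrite natrM sN.
have q5 := sqrtr_natr_sqr 5; have q50 := sqrtr_ge0 (5%:R : R).
set q := Num.sqrt 5%:R in q5 q50 *.
have q2 := sqrtr_natr_sqr 2; have q20 := sqrtr_ge0 (2%:R : R).
set r := Num.sqrt 2%:R in q2 q20 *.
have P2 := sqrtr_natr_sqr ((beta + t) ^ 2 + 1).
have P0 := sqrtr_ge0 (((beta + t) ^ 2 + 1)%N%:R : R).
set P := Num.sqrt ((beta + t) ^ 2 + 1)%N%:R in P2 P0 *.
have Q2 := sqrtr_natr_sqr ((beta + t) ^ 2 + 4).
have Q0 := sqrtr_ge0 (((beta + t) ^ 2 + 4)%N%:R : R).
set Q := Num.sqrt ((beta + t) ^ 2 + 4)%N%:R in Q2 Q0 *.
have K2 := sqrtr_natr_sqr k; have K0 := sqrtr_ge0 (k%:R : R).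
set K := Num.sqrt k%:R in K2 K0 *.
rewrite natrD natrX sD in P2; rewrite natrD natrX sD in Q2.
(* The fractions 161/72 and 41/29 are continued fraction convergents, just above sqrt 5 and just
   below sqrt 2. *)
have q_hi : q <= 161 / 72 by apply: le_of_sqr; rewrite ?q5; lra.
have r_lo : 41 / 29 <= r by apply: le_of_sqr => //; rewrite q2; lra.
have d3 : 3 <= beta%:R + t%:R :> R by rewrite -natrD ler_nat.
have PD : beta%:R + t%:R <= P by apply: le_of_sqr => //; rewrite P2; lra.
have t0 : 0 <= t%:R :> R by rewrite ler0n.
have tN : 2 * t%:R <= beta%:R + t%:R - 1 :> R.
  by rewrite -sN -natrM ler_nat.
have qr : 0 <= t%:R * (r - 41 / 29) by apply: mulr_ge0; lra.
have qq : 0 <= t%:R * (161 / 72 - q) by apply: mulr_ge0; lra.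
(* 17/72 = 161/72 - 2 and 41/100 > 1 + 161/72 - 2 * (41/29). *)
suff: 17 / 72 + 41 / 100 * t%:R < (beta%:R + t%:R - 1) * (Q - K) by lra.
have [D_3|D_3] := eqVneq (beta + t)%N 3.
  have d : beta%:R + t%:R = 3 :> R by rewrite -natrD D_3.
  rewrite D_3 eqxx in kle.
  have k8 : k%:R <= 8 :> R by rewrite ler_nat.
  have QK : 18 / 5 <= Q by apply: le_of_sqr => //; rewrite Q2 d; lra.
  have KK : K <= 17 / 6 by apply: le_of_sqr; rewrite ?K2; lra.
  rewrite d; lra.
rewrite (negPf D_3) in kle.
have [D_4|D_4] := eqVneq (beta + t)%N 4.
  have d : beta%:R + t%:R = 4 :> R by rewrite -natrD D_4.
  rewrite D_4 in kle.
  have k8 : k%:R <= 18 :> R by rewrite ler_nat.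
  have QK : 76 / 17 <= Q by apply: le_of_sqr => //; rewrite Q2 d; lra.
  have KK : K <= 297 / 70 by apply: le_of_sqr; rewrite ?K2; lra.
  (* Integrality matters here: the real bound 2t <= 3 would allow t = 3/2, for which the estimate is
     too weak. *)
  have t1 : t%:R <= 1 :> R by rewrite lern1 D4_nat.
  rewrite d; lra.
have d5 : 5 <= beta%:R + t%:R :> R by rewrite -natrD ler_nat D5_nat.
have kR : k%:R <= (beta%:R + t%:R - 1) ^+ 2 + 9 :> R.
  by rewrite -sN -natrX -natrD ler_nat.
set d : R := beta%:R + t%:R in Q2 d5 kR tN *.
have Qd : Q <= d + 2 / 5 by apply: le_of_sqr; rewrite ?Q2; lra.
have dQ : d <= Q by apply: le_of_sqr => //; rewrite Q2; lra.
(* This uniform gap needs D >= 5: at D = 4 the difference sqrt 20 - sqrt 18 is below 1/3. *)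
have gap : K <= Q - 1 / 3.
  by apply: le_of_sqr; rewrite ?K2 ?sqrrB ?Q2; lra.
have : 0 <= (d - 1) * (Q - K - 1 / 3) by apply: mulr_ge0; lra.
lra.
Qed.
End Weights.

(** * The strict inequality when no vertex has degree D *)

Section SomborBound.
Variables (R : rcfType) (T : finType) (e : rel T) (mu : T -> T) (beta t : nat).
Hypotheses (es : symmetric e) (ei : irreflexive e) (ec : connected_graph e).
Hypotheses (mateE : mate_of e mu) (cardT : #|T| = (2 * beta)%N).
Hypotheses (beta2 : (2 <= beta)%N) (t_beta : (t < beta)%N).
Hypothesis sum_nmdeg : (\sum_x nmdeg e mu x <= 2 * (beta + t - 1))%N.

Let w x y : R := weight R (deg e x) (deg e y).

Lemma sombor_split : 2 * sombor e R =
  \sum_x w x (mu x) + \sum_x \sum_(y | nm e mu x y) w x y.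
Proof.
rewrite /sombor mulrA mulfV ?mul1r ?pnatr_eq0 // -big_split /=.
apply: eq_bigr => x _; rewrite (bigD1 (mu x)) ?(e_mu mateE) //=.
Qed.

(** Sums [weight_le_linear], whose condition on the degree sum comes from [nmdeg_mate_gt0]. The
    factor 2 appears because each matching edge is visited from both ends. *)
Lemma sum_w_mate_le :
  \sum_x w x (mu x) <= 2 * (beta%:R * (Num.sqrt 5 - 1) + (2 * (beta + t - 1))%N%:R).
Proof.
have degw x : w x (mu x) <=
    (nmdeg e mu x)%:R + (nmdeg e mu (mu x))%:R + (Num.sqrt 5 - 1).
  rewrite /w !(degE mateE); apply: le_trans (weight_le_linear _ _ _ _) _ => //.
    have := nmdeg_mate_gt0 es mateE x ec; rewrite cardT; lia.
  rewrite -!natr1; lra.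
apply: (le_trans (ler_sum _ (fun x _ => degw x))).
rewrite big_split /= big_split /= sumr_const cardT.
have -> : \sum_x (nmdeg e mu (mu x))%:R = \sum_x (nmdeg e mu x)%:R :> R.
  by rewrite [RHS](reindex_inj (inv_inj (muK mateE))).
have : \sum_x (nmdeg e mu x)%:R <= (2 * (beta + t - 1))%N%:R :> R.
  by rewrite -natr_sum ler_nat.
rewrite -[_ *+ (2 * beta)]mulr_natl (natrM _ 2 beta); lra.
Qed.

Lemma sombor_lt : (forall c, nmdeg e mu c < beta + t - 1)%N ->
  sombor e R < Phi R beta t.
Proof.
move=> small.
have /card_gt0P[x0 _] : (0 < #|T|)%N by rewrite cardT; lia.
(* Either [x0] or its mate has a free edge, so 1 is a free degree bound from below there, while
   [small] keeps it under D - 1. *)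
have D3 : (2 < beta + t)%N.
  have := nmdeg_mate_gt0 es mateE x0 ec; rewrite cardT.
  have := small x0; have := small (mu x0); lia.
pose k := (if beta + t == 3 then 8 else (beta + t - 1) ^ 2 + 9)%N.
have wk x y : nm e mu x y -> w x y <= Num.sqrt k%:R.
  move=> nxy; apply: le_sqrt_nat.
  have := nm_edge_le es ei mateE nxy; have := small x; have := small y.
  have := nmdeg_gt0 nxy; have := nxy; rewrite (nm_sym es mateE) => /nmdeg_gt0.
  rewrite !(degE mateE) /k; move: sum_nmdeg.
  move: (nmdeg e mu x) (nmdeg e mu y) (\sum_x _)%N => a b s sle b1 a1 bl al le.
  have {sle le} : (a + b <= beta + t)%N by lia.
  (* For D = 3 both ends of a free edge have degree 2, giving 8. Otherwise [sum_squares_le] applies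
     with m = D - 1, as the end degrees sum to at most D + 2. *)
  case: eqP => D ab.
    have [-> ->] : a = 1%N /\ b = 1%N by lia.
    by [].
  by apply: sum_squares_le; lia.
have := Phi_gap R D3 t_beta (leqnn k); rewrite -/k => gap.
have := sombor_split; have := sum_w_mate_le.
have : \sum_x \sum_(y | nm e mu x y) w x y
    <= (2 * (beta + t - 1))%N%:R * Num.sqrt k%:R.
  apply: (@le_trans _ _ (\sum_x (nmdeg e mu x)%:R * Num.sqrt k%:R)).
    apply: ler_sum => x _; rewrite /nmdeg natr_sum mulr_suml big_mkcond /=.
    apply: ler_sum => y _; case nxy: (nm e mu x y); last by rewrite mul0r.
    by rewrite mul1r wk.
  by rewrite -mulr_suml -natr_sum ler_wpM2r ?sqrtr_ge0 // ler_nat.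
rewrite natrM -/k; lra.
Qed.

End SomborBound.

(** * A vertex of degree D forces H* *)

Section Extremal.
Variables (T : finType) (e : rel T) (mu : T -> T) (beta t : nat) (c : T).
Hypotheses (es : symmetric e) (ei : irreflexive e) (ec : connected_graph e).
Hypotheses (mateE : mate_of e mu) (cardT : #|T| = (2 * beta)%N).
Hypotheses (beta2 : (2 <= beta)%N) (t_beta : (t < beta)%N).
Hypothesis sum_nmdeg : (\sum_x nmdeg e mu x <= 2 * (beta + t - 1))%N.
Hypothesis nmdeg_c : (beta + t - 1 <= nmdeg e mu c)%N.

Local Notation nm := (nm e mu).
Local Notation nmd := (nmdeg e mu).

Lemma center_nmdeg : nmd c = (beta + t - 1)%N.
Proof. by have := nmdeg2_le es ei mateE c; lia. Qed.

Lemma star_nmdeg x : x != c -> nmd x = nm x c.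
Proof. by apply: nmdeg_center => //; lia. Qed.

Lemma star_sum_nmdeg : (\sum_x nmd x = 2 * (beta + t - 1))%N.
Proof. by have := nmdeg2_le es ei mateE c; lia. Qed.

Lemma star_nm x y : nm x y = (x == c) && nm c y || (y == c) && nm c x.
Proof.
have [->|xc] /= := eqVneq x c; first by rewrite (nm_irr mu ei) andbF orbF.
have [->|yc] /= := eqVneq y c; first exact: nm_sym.
apply/negP=> nxy; have /eqP := star_nmdeg xc.
have cy : c != y by rewrite eq_sym.
rewrite /nmdeg (bigD1 y) //= (bigD1 c) //= nxy; case: (nm x c); lia.
Qed.

Variable R : rcfType.

(** Free edges all weigh sqrt(D^2 + 4) and the matching edge at [c] weighs sqrt(D^2 + 1). Any other
    matching edge weighs sqrt 5 or 2 sqrt 2, as one or both of its ends are free neighbours of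
    [c]. *)
Lemma extremal_sombor : sombor e R = Phi R beta t.
Proof.
pose q : R := Num.sqrt 5; pose r : R := Num.sqrt 2.
have r8 : Num.sqrt 8 = 2 * r.
  have -> : 8 = 2 ^+ 2 * 2 :> R by rewrite -natrX -natrM.
  by rewrite sqrtrM ?sqr_ge0 // sqrtr_sqr ger0_norm.
pose Q : R := weight R (beta + t) 2; pose P : R := weight R (beta + t) 1.
have degc : deg e c = (beta + t)%N by rewrite (degE mateE) center_nmdeg; lia.
have S1 x : nm c x -> deg e x = 2.
  move=> cx; rewrite (degE mateE) star_nmdeg; first by rewrite nm_sym // cx.
  by apply/eqP=> E; rewrite E (nm_irr mu ei) in cx.
have wQ x y : nm x y -> weight R (deg e x) (deg e y) = Q.
  rewrite star_nm => /orP[]/andP[/eqP-> /S1->]; rewrite degc //.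
  exact: weightC.
have sumQ : \sum_x \sum_(y | nm x y) weight R (deg e x) (deg e y) =
    (2 * (beta + t - 1))%N%:R * Q.
  rewrite -star_sum_nmdeg natr_sum mulr_suml; apply: eq_bigr => x _.
  rewrite /nmdeg natr_sum mulr_suml big_mkcond; apply: eq_bigr => y _.
  by case nxy: (nm x y); rewrite ?mul0r ?mul1r ?wQ.
have mc0 : nmd (mu c) = 0%N.
  by rewrite star_nmdeg ?(mu_neq ei mateE) // nm_sym // nm_mu.
have cm : mu c != c by exact: mu_neq mateE c.
(* The affine function of the free degree sum with value sqrt 5 at 1 and 2 sqrt 2 at 2. Its total
   follows from [star_sum_nmdeg] without counting the two kinds of edges; only the terms at [c] and
   [mu c] need correcting. *)
pose g x : R := q + (nmd x + nmd (mu x))%N%:R * (2 * r - q) - (2 * r - q).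
have wg x : x != c -> x != mu c -> weight R (deg e x) (deg e (mu x)) = g x.
  move=> xc xm.
  have mxc : mu x != c by rewrite -(inj_eq (inv_inj (muK mateE))) (muK mateE).
  have := nmdeg_mate_gt0 es mateE x ec; rewrite cardT /g !(degE mateE).
  rewrite !star_nmdeg //; case: (nm x c); case: (nm (mu x) c) => /= H.
  - by rewrite /weight r8; ring.
  - by rewrite weightC /weight /q; ring.
  - by rewrite /weight /q; ring.
  - by suff : false by []; apply: H; lia.
have sum_g : \sum_x g x = (2 * beta)%N%:R * (q - (2 * r - q))
    + (4 * (beta + t - 1))%N%:R * (2 * r - q).
  have sum_const (k : R) : \sum_(x : T) k = (2 * beta)%N%:R * k.
    by rewrite sumr_const cardT mulr_natl.
  rewrite big_split big_split /= -mulr_suml !sum_const -natr_sum big_split /=.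
  have -> : (\sum_x nmd (mu x) = \sum_x nmd x)%N.
    by rewrite [RHS](reindex_inj (inv_inj (muK mateE))).
  rewrite star_sum_nmdeg -mulnDl [(2 + 2)%N]/=; ring.
have sumP : \sum_x weight R (deg e x) (deg e (mu x)) =
    \sum_x g x + 2 * (P - q - (beta + t - 1)%N%:R * (2 * r - q) + (2 * r - q)).
  apply/eqP; rewrite -subr_eq0 opprD addrA -sumrB subr_eq0; apply/eqP.
  rewrite (bigD1 c) //= (bigD1 (mu c)) //= big1 => [|x /andP[xc xm]]; last first.
    by rewrite wg // subrr.
  rewrite /g (muK mateE) degc center_nmdeg !(degE mateE) mc0 addn0 add0n.
  by rewrite (weightC _ 1) -/P; ring.
have := sombor_split R mateE; rewrite sumQ sumP sum_g.
rewrite !natrM natrB ?natrD; last lia.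
rewrite /Phi -/q -/r.
have -> : Num.sqrt ((beta + t) ^ 2 + 4)%N%:R = Q by [].
have -> : Num.sqrt ((beta + t) ^ 2 + 1)%N%:R = P by [].
lra.
Qed.

(* One endpoint of every matching edge avoiding the center, always a neighbour
   of c; the t edges lying in triangles come first. *)
Let twin : {set T} := [set x | [&& nm c x, nm c (mu x) &
  enum_rank x < enum_rank (mu x)]%N].
Let single : {set T} := [set x | nm c x && ~~ nm c (mu x)].
Let reps : seq T := enum twin ++ enum single.

Lemma nm_center_neq x : nm c x -> x != c.
Proof. by move=> cx; apply/eqP=> E; rewrite E (nm_irr mu ei) in cx. Qed.

Lemma nm_center_mate x : x != c -> x != mu c -> nm c x || nm c (mu x).
Proof.
move=> xc xm.
have mxc : mu x != c by rewrite -(inj_eq (inv_inj (muK mateE))) (muK mateE).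
have := nmdeg_mate_gt0 es mateE x ec; rewrite cardT !star_nmdeg //.
rewrite !(nm_sym es mateE _ c); case: (nm c x); case: (nm c (mu x)) => //= H.
by apply: H; lia.
Qed.

Lemma card_nm_center : #|[set x | nm c x]| = (beta + t - 1)%N.
Proof.
rewrite -center_nmdeg /nmdeg -sum1_card big_mkcond /=.
by apply: eq_bigr => x _; rewrite inE; case: ifP.
Qed.

(** The mates of [single] are the ends of the paths: all vertices except [c], its mate and the
    [beta + t - 1] free neighbours of [c]. *)
Lemma card_single : #|single| = (beta - t - 1)%N.
Proof.
rewrite -(card_imset _ (inv_inj (muK mateE))).
have -> : mu @: single = ~: (c |: (mu c |: [set x | nm c x])).
  apply/setP=> x; rewrite !inE !negb_or; apply/imsetP/and3P.
    case=> y; rewrite inE => /andP[cy cmy] ->; split=> //.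
      by apply: contraTneq cy => <-; rewrite (nm_sym es mateE) nm_mu.
    rewrite (inj_eq (inv_inj (muK mateE))); exact: nm_center_neq.
  case=> xc xm cx; exists (mu x); last by rewrite (muK mateE).
  have := nm_center_mate xc xm; rewrite inE (muK mateE) (negPf cx) /=.
  by rewrite andbT.
have := cardsC (c |: (mu c |: [set x | nm c x])).
rewrite !cardsU1 card_nm_center !inE cardT (nm_irr mu ei) nm_mu.
have /negPf cm : c != mu c by rewrite eq_sym (mu_neq ei mateE).
by rewrite cm /=; lia.
Qed.

(** The free neighbours of [c] outside [single] pair off into [twin] and its mates, [enum_rank]
    choosing one from each pair, so twice the count is (beta + t - 1) - (beta - t - 1). *)
Lemma card_twin : #|twin| = t.
Proof.
have rank x : enum_rank x != enum_rank (mu x) :> nat.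
  by rewrite (inj_eq val_inj) (inj_eq enum_rank_inj) eq_sym (mu_neq ei mateE).
have dis : [disjoint twin & mu @: twin].
  apply/pred0P=> x /=; apply/negbTE/negP=> /andP[]; rewrite inE => /and3P[_ _ l].
  case/imsetP=> y; rewrite inE => /and3P[_ _ l'] E.
  by move: l; rewrite E (muK mateE); lia.
have U : [set x | nm c x] :\: single = twin :|: mu @: twin.
  apply/setP=> x; rewrite !inE.
  have -> : (x \in mu @: twin) = (mu x \in twin).
    apply/imsetP/idP=> [[y ty ->]|tx]; first by rewrite (muK mateE).
    by exists (mu x); rewrite // (muK mateE).
  rewrite inE (muK mateE); move: (rank x).
  case: (nm c x); case: (nm c (mu x)) => //=; rewrite ?andbT ?andbF //.
  by case: ltngtP.
have := cardsD [set x | nm c x] single.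
rewrite U cardsU (disjoint_setI0 dis) cards0.
rewrite card_imset; last exact: inv_inj (muK mateE).
rewrite (setIidPr _) ?card_nm_center ?card_single; first lia.
by apply/subsetP=> x; rewrite !inE => /andP[].
Qed.

Lemma size_reps : size reps = (beta - 1)%N.
Proof. by rewrite size_cat -!cardE card_twin card_single; lia. Qed.

Lemma mem_reps x : (x \in reps) =
  nm c x && (nm c (mu x) ==> (enum_rank x < enum_rank (mu x))%N).
Proof.
rewrite mem_cat !mem_enum !inE.
by case: (nm c x); case: (nm c (mu x)) => //=; rewrite ?orbF.
Qed.

Lemma mem_reps_mate x : x != c -> x != mu c -> (mu x \in reps) = (x \notin reps).
Proof.
move=> xc xm; have := nm_center_mate xc xm; rewrite !mem_reps (muK mateE).
have : enum_rank x != enum_rank (mu x) :> nat.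
  by rewrite (inj_eq val_inj) (inj_eq enum_rank_inj) eq_sym (mu_neq ei mateE).
by case: (nm c x); case: (nm c (mu x)) => //=; case: ltngtP.
Qed.

Lemma index_reps_lt x : x \in reps -> (index x reps < t)%N = nm c (mu x).
Proof.
rewrite mem_reps index_cat mem_enum => /andP[cx].
have [cmx /= lt|cmx _] := boolP (nm c (mu x)).
  have xt : x \in twin by rewrite inE cx cmx.
  by rewrite xt -card_twin cardE index_mem mem_enum.
rewrite inE (negPf cmx) andbF -card_twin cardE.
by rewrite ltnNge leq_addr.
Qed.

Let rep x := if x \in reps then x else mu x.

(** The isomorphism onto H*: the center goes to 0, its mate to the pendant label, and the pair with
    representative number [k] to the two labels [Hstar_pos t k], representative first. *)
Let code x : nat := if x == c then 0%N else if x == mu c then (2 * t + 1)%N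
  else Hstar_pos t (index (rep x) reps) (x \notin reps).

Lemma rep_mem x : x != c -> x != mu c -> rep x \in reps.
Proof. by move=> xc xm; rewrite /rep; case: ifPn => //; rewrite mem_reps_mate. Qed.

Lemma code_lt x : (code x < 2 * beta)%N.
Proof.
rewrite /code; case: eqVneq => [_|xc]; first lia.
case: eqVneq => [_|xm]; first lia.
have := rep_mem xc xm; rewrite -index_mem size_reps /Hstar_pos.
by case: (x \in reps) => /=; lia.
Qed.

Lemma code_inj : injective code.
Proof.
move=> x y; rewrite /code.
have mc := mu_neq ei mateE c.
have [->|xc] := eqVneq x c; have [->|yc] := eqVneq y c => //.
- case: eqP => _; first lia.
  by move/esym/eqP; rewrite (negPf (Hstar_pos_neq0 _ _ _)).
- case: eqP => _; first lia.
  by move/eqP; rewrite (negPf (Hstar_pos_neq0 _ _ _)).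
have [->|xm] := eqVneq x (mu c); have [->|ym] := eqVneq y (mu c) => //.
- by move/esym/eqP; rewrite (negPf (Hstar_pos_neq _ _ _)).
- by move/eqP; rewrite (negPf (Hstar_pos_neq _ _ _)).
case/Hstar_pos_inj => /(index_inj x (rep_mem xc xm) (rep_mem yc ym)).
rewrite /rep; case: (x \in reps); case: (y \in reps) => // E _.
exact: inv_inj (muK mateE) _ _ E.
Qed.

Lemma code_mate x : code (mu x) = Hstar_mate t (code x).
Proof.
have mc := mu_neq ei mateE c.
have mK := muK mateE; have mI := inj_eq (inv_inj mK).
rewrite /code mI -[mu x == c]mI mK.
have [->|xc] := eqVneq x c.
  by rewrite eq_sym (negPf mc).
have [_|xm] := eqVneq x (mu c).
  by rewrite /Hstar_mate eqxx addn1.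
rewrite Hstar_mate_pos /rep mem_reps_mate // mK.
by case: (x \in reps).
Qed.

(** Since [reps] lists [twin] first, the pairs with index below [t] are those with both ends
    adjacent to [c], in agreement with [Hstar_star_pos]. *)
Lemma code_star x : nm c x = Hstar_star t (code x).
Proof.
rewrite /code; have [->|xc] := eqVneq x c.
  by rewrite (nm_irr mu ei) /Hstar_star /=; lia.
have [->|xm] := eqVneq x (mu c).
  rewrite nm_mu /Hstar_star oddD oddM /=; lia.
rewrite Hstar_star_pos negbK index_reps_lt ?rep_mem //.
have := mem_reps x; rewrite /rep; case: ifPn => xr /=; first by case: (nm c x).
by rewrite (muK mateE).
Qed.

(** Both graphs are a matching plus a star at the center, and [code] respects both pieces; being
    injective between sets of equal size, it is bijective. *)
Lemma extremal_isomorphic : isomorphic e (Hstar beta t).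
Proof.
exists (fun x => Ordinal (code_lt x)); split.
  apply: inj_card_bij; last by rewrite card_ord cardT.
  by move=> x y [] /code_inj.
move=> x y; rewrite /Hstar /= Hstar_edgeE -code_mate (inj_eq code_inj).
rewrite (edgeE mateE) star_nm -!code_star.
have c0 z : (code z == 0%N) = (z == c).
  rewrite -(inj_eq code_inj); congr (_ == _); by rewrite /code eqxx.
by rewrite !c0.
Qed.
End Extremal.

(** * The two cases combined *)

Unset Implicit Arguments.

Theorem theorem4p4 (R : rcfType) (T : finType) (e : rel T) (beta t : nat) :
  (2 <= beta)%N ->
  #|T| = (2 * beta)%N ->
  simple_graph e ->
  connected_graph e ->
  cactus e ->
  num_cycles e = t ->
  has_perfect_matching e ->
  sombor e R <= Phi R beta t /\
  (sombor e R = Phi R beta t <-> isomorphic e (Hstar beta t)).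
Proof.
move=> beta2 cardT [es ei] ec cact numt /(perfect_matching_mate es ei)[mu mateE].
have T0 : #|T| != 0%N by rewrite cardT; lia.
have t_beta : (t < beta)%N.
  by have := cactus_num_cycles_lt es ei cact T0; rewrite numt cardT; lia.
have sum_deg : (\sum_x deg e x = \sum_x nmdeg e mu x + 2 * beta)%N.
  rewrite -cardT -sum1_card -big_split; apply: eq_bigr => x _ /=.
  by rewrite (degE mateE) addn1.
have sum_nmdeg : (\sum_x nmdeg e mu x <= 2 * (beta + t - 1))%N.
  by have := sum_deg_le es ei T0; rewrite sum_deg numt cardT; lia.
have [[c nc]|small] : (exists c, beta + t - 1 <= nmdeg e mu c)%N \/
    (forall c, nmdeg e mu c < beta + t - 1)%N.
  case: (pickP (fun c => beta + t - 1 <= nmdeg e mu c)%N) => [c|] H.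
    by left; exists c.
  by right=> c; rewrite ltnNge H.
  have E := extremal_sombor es ei ec mateE cardT beta2 t_beta sum_nmdeg nc R.
  split; first by rewrite E.
  split=> // _.
  exact: extremal_isomorphic es ei ec mateE cardT beta2 t_beta sum_nmdeg nc.
have lt := sombor_lt R es ei ec mateE cardT beta2 t_beta sum_nmdeg small.
split; first exact: ltW.
split=> [E|[f [[g fK gK] fE]]]; first by rewrite E ltxx in lt.
(* An isomorphism would carry the center of H*, of degree D, to a vertex of degree D, against
   [small]. *)
have beta0 : (0 < 2 * beta)%N by lia.
have deg0 := Hstar_center_deg t_beta (erefl (Ordinal beta0 : nat)).
suff : deg e (g (Ordinal beta0)) = (beta + t)%N.
  by rewrite (degE mateE); have := small (g (Ordinal beta0)); lia.
rewrite -deg0 /deg -(card_image (can_inj gK)).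
apply: eq_card => y; apply/idP/imageP.
  by rewrite inE => gy; exists (f y); rewrite ?fK // inE -fE gK in gy *.
by case=> z; rewrite !inE => hz ->; rewrite -fE !gK.
Qed.
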